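(* Let $n$ be an even positive integer and let $\vec e_1,\dots,\vec e_n\in\mathbb{R}^3$ be the edge vectors (in cyclic order) of a closed polygonal curve in $\mathbb{R}^3$. Then $\operatorname{sb}(\vec e_1,\dots,\vec e_n)<\frac{n}{2}$ if and only if there exists a nonzero vector $\vec u\in\mathbb{R}^n$ with nonnegative entries solving the matrix equation $$\left[\,\vec e_1\,|\,-\vec e_2\,|\,\cdots\,|\,-\vec e_n\,\right]\vec u=\vec 0,$$ where the matrix on the left is the $3\times n$ matrix whose $i$-th column is $(-1)^{i+1}\vec e_i$.
   Context: A closed polygonal curve with vertices $\vec v_1,\dots,\vec v_n\in\mathbb{R}^3$ has edge vectors $\vec e_i=\vec v_{i+1}-\vec v_i$, with indices taken cyclically (so $\vec e_n=\vec v_1-\vec v_n$ and $\vec e_{n+1}=\vec e_1$). For $\vec v\in S^2$, the number of local maxima of the projection of the curve to the line spanned by $\vec v$ is $$\operatorname{b}_{\vec v}(\vec e_1,\dots,\vec e_n)=\#\{i\in\{1,\dots,n\} : \vec e_i\cdot\vec v>0 \text{ and } \vec e_{i+1}\cdot\vec v<0\},$$ where $\cdot$ is the usual dot product on $\mathbb{R}^3$. The superbridge number of the polygonal curve is $\operatorname{sb}(\vec e_1,\dots,\vec e_n)=\max_{\vec v\in S^2}\operatorname{b}_{\vec v}(\vec e_1,\dots,\vec e_n)$. *)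

(* Defs.v *)
From HB Require Import structures.
From mathcomp Require Import all_boot all_order all_algebra.
From mathcomp Require Import boolp reals.

Set Implicit Arguments.
Unset Strict Implicit.
Unset Printing Implicit Defensive.

Import Order.TTheory GRing.Theory Num.Theory.
Local Open Scope ring_scope.

Definition dot (R : realType) (x y : 'cV[R]_3) : R :=
  \sum_(k < 3) x k 0 * y k 0.

Definition on_S2 (R : realType) (v : 'cV[R]_3) : Prop := dot v v = 1.

(* The vertices and edges are indexed by 0, ..., n - 1, and [ordS] is the
   successor modulo n, so the last edge goes back to the first vertex. *)
Definition edge (R : realType) (n : nat) (v : 'I_n -> 'cV[R]_3) (i : 'I_n)
  : 'cV[R]_3 := v (ordS i) - v i.

Definition bridge (R : realType) (n : nat) (e : 'I_n -> 'cV[R]_3)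
    (v : 'cV[R]_3) : nat :=
  #|[set i : 'I_n | (0 < dot (e i) v) && (dot (e (ordS i)) v < 0)]|.

(* The maximum of the set of values taken by [bridge e] on the sphere, all of
   which are at most n; [bridge_le_superbridge] and [superbridge_attained]
   state that it is a genuine, attained maximum. *)
Definition superbridge (R : realType) (n : nat) (e : 'I_n -> 'cV[R]_3) : nat :=
  \max_(k < n.+1 | `[< exists v, on_S2 v /\ bridge e v = k >]) k.

(* With indices starting from 0, column i (from 1, column i + 1) has sign
   (-1)^i. *)
Definition alternating_mx (R : realType) (n : nat) (e : 'I_n -> 'cV[R]_3)
  : 'M[R]_(3, n) := \matrix_(k < 3, i < n) ((-1) ^+ i * e i k 0).

Lemma bridge_le_size (R : realType) (n : nat) (e : 'I_n -> 'cV[R]_3)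
  (v : 'cV[R]_3) : (bridge e v <= n)%N.
Proof. by rewrite /bridge -[leqRHS]card_ord max_card. Qed.

Lemma bridge_le_superbridge (R : realType) (n : nat) (e : 'I_n -> 'cV[R]_3)
  (v : 'cV[R]_3) : on_S2 v -> (bridge e v <= superbridge e)%N.
Proof.
move=> v1; have lt_b : (bridge e v < n.+1)%N by rewrite ltnS bridge_le_size.
rewrite /superbridge (bigD1 (Ordinal lt_b)) ?leq_maxl //=.
by apply/asboolP; exists v.
Qed.

Lemma superbridge_attained (R : realType) (n : nat) (e : 'I_n -> 'cV[R]_3) :
  exists v, on_S2 v /\ bridge e v = superbridge e.
Proof.
have S2w : on_S2 (delta_mx 0 0 : 'cV[R]_3).
  rewrite /on_S2 /dot (bigD1 0) //= big1 => [|k /negbTE k0]; rewrite !mxE ?k0 /=.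
    by rewrite mulr1 addr0.
  by rewrite mul0r.
pose w : 'cV[R]_3 := delta_mx 0 0.
have lt_b : (bridge e w < n.+1)%N by rewrite ltnS bridge_le_size.
have Pb : `[< exists v, on_S2 v /\ bridge e v = Ordinal lt_b >].
  by apply/asboolP; exists w.
rewrite /superbridge (bigop.bigmax_eq_arg (Ordinal lt_b)) //.
by case: arg_maxnP => // k /asboolP.
Qed.

(* Main.v *)
Require Import Defs.
From HB Require Import structures.
From mathcomp Require Import all_boot all_order all_algebra.
From mathcomp Require Import boolp reals.
From mathcomp Require Import ring.

Set Implicit Arguments.
Unset Strict Implicit.
Unset Printing Implicit Defensive.

Import Order.TTheory GRing.Theory Num.Theory.
Local Open Scope ring_scope.

(** Edges counted by [bridge e w] have a positive dot product with [w] and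
    their cyclic successors a negative one, so these two sets of indices are
    disjoint and [bridge e w <= n./2].  If equality holds and [n] is even, they
    cover all indices, so the signs of the [dot (e i) w] alternate around the
    polygon; up to replacing [w] by [- w], every [(-1) ^+ i * dot (e i) w] is
    positive.  Conversely, as [n] is even, such a [w], rescaled to the sphere,
    attains [n./2].

    Hence the superbridge number is less than [n./2] exactly when no [w] has
    positive dot product with all columns [(-1) ^+ i *: e i] of
    [alternating_mx e].  By Gordan's theorem of the alternative ([gordan],
    [gordan_exclusive]), this means that a nontrivial nonnegative combination
    of these columns vanishes. *)

(** * Gordan's theorem of the alternative *)

(** It suffices that [t * (`|q i| / p i) < 1] for all [i].  The inverse of
    [1 + \sum_i `|q i| / p i] achieves this without a case distinction on [q i]
    or a minimum over [I]. *)
Lemma small_perturbation (F : realFieldType) (I : finType) (p q : I -> F) :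
  (forall i, 0 < p i) -> exists2 t : F, 0 < t & forall i, 0 < p i + t * q i.
Proof.
move=> p_gt0; pose r i := `|q i| / p i.
have r_ge0 i : 0 <= r i by rewrite divr_ge0 // ltW.
have s_gt0 : 0 < 1 + \sum_i r i.
  by rewrite ltr_pwDl // sumr_ge0.
exists (1 + \sum_i r i)^-1 => [|i]; first by rewrite invr_gt0.
have: r i < 1 + \sum_i r i.
  rewrite (bigD1 i) //= addrCA ltrDl ltr_pwDl //.
  by rewrite sumr_ge0.
rewrite ltr_pdivrMr // => lt_q.
rewrite -[X in X + _](mulKf (lt0r_neq0 s_gt0)) -mulrDr mulr_gt0 ?invr_gt0 //.
rewrite -[q i]opprK subr_gt0; apply: le_lt_trans lt_q.
by rewrite -normrN ler_norm.
Qed.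

Lemma mulmx_rV_gt0 (F : realFieldType) (n : nat) (u : 'rV[F]_n) (x : 'cV[F]_n) :
  u != 0 -> (forall i, 0 <= u 0 i) -> (forall i, 0 < x i 0) ->
  0 < (u *m x) 0 0.
Proof.
move=> u_neq0 u_ge0 x_gt0; have [i ui_neq0] : exists i, u 0 i != 0.
  by apply/rV0Pn.
rewrite mxE (bigD1 i) //= ltr_pwDl //.
  by rewrite mulr_gt0 // lt0r ui_neq0 u_ge0.
by rewrite sumr_ge0 // => j _; rewrite mulr_ge0 // ltW.
Qed.

Lemma gordan_exclusive (F : realFieldType) (m n : nat) (A : 'M[F]_(n, m))
    (u : 'rV[F]_n) (w : 'cV[F]_m) :
  u != 0 -> (forall i, 0 <= u 0 i) -> u *m A = 0 ->
  ~ (forall i, 0 < (A *m w) i 0).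
Proof.
move=> u_neq0 u_ge0 uA0 Aw_gt0.
have := mulmx_rV_gt0 u_neq0 u_ge0 Aw_gt0.
by rewrite mulmxA uA0 mul0mx mxE ltxx.
Qed.

Lemma rV_norm_gt0 (F : realFieldType) (m : nat) (a : 'rV[F]_m) :
  a != 0 -> 0 < (a *m a^T) 0 0.
Proof.
move=> /rV0Pn[k ak_neq0]; rewrite mxE (bigD1 k) //= mxE ltr_pwDl //.
  by rewrite -expr2 exprn_even_gt0.
by rewrite sumr_ge0 // => j _; rewrite mxE -expr2 sqr_ge0.
Qed.

(** Induction on the number of rows.  Split off a nonzero row [a] and apply the
    induction hypothesis to the orthogonal projections of the other rows along
    [a].  If they lie in an open half-space, then [w] can be taken orthogonal to
    [a], and tilting it slightly towards [a] makes it positive on [a] too.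
    Otherwise a nonnegative combination of the other rows equals [c] times [a]:
    if [c <= 0] this is a relation on all rows, and if [c > 0] then [a] is in
    the cone of the other rows, so that the induction hypothesis for these rows
    themselves suffices. *)
Lemma gordan (F : realFieldType) (m n : nat) (A : 'M[F]_(n, m)) :
  (exists w : 'cV[F]_m, forall i, 0 < (A *m w) i 0) \/
  (exists u : 'rV[F]_n, [/\ u != 0, forall i, 0 <= u 0 i & u *m A = 0]).
Proof.
elim: n A => [|n IHn] A; first by left; exists 0 => -[].
change ('M[F]_(1 + n, m)) in (type of A).
pose a : 'rV_m := usubmx A; pose B : 'M_(n, m) := dsubmx A.
have defA : A = col_mx a B by rewrite vsubmxK.
have A_gt0 w : 0 < (a *m w) 0 0 -> (forall i, 0 < (B *m w) i 0) ->
    forall i, 0 < (A *m w) i 0.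
  move=> aw_gt0 Bw_gt0 i; rewrite defA mul_col_mx.
  by case: (split_ordP i) => j ->; rewrite ?col_mxEu ?col_mxEd // ord1.
have relA (c : F) (u : 'rV_n) : 0 <= c -> (forall i, 0 <= u 0 i) ->
    (c != 0) || (u != 0) -> c *: a + u *m B = 0 ->
    exists u : 'rV[F]_(1 + n), [/\ u != 0, forall i, 0 <= u 0 i & u *m A = 0].
  move=> c_ge0 u_ge0 cu_neq0 rel0; exists (row_mx c%:M u); split.
  - apply: contraTneq cu_neq0 => /eqP; rewrite -row_mx0.
    move=> /eqP/eq_row_mx[c0 ->].
    by move/matrixP/(_ 0 0): c0; rewrite !mxE mulr1n => ->; rewrite !eqxx.
  - move=> i; case: (split_ordP i) => j ->; rewrite ?row_mxEl ?row_mxEr //.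
    by rewrite ord1 mxE.
  - by rewrite defA mul_row_col mul_scalar_mx.
have [a0|a_neq0] := eqVneq a 0.
  right; apply: (relA 1 0) => [||//|]; rewrite ?ler01 ?oner_eq0 //.
    by move=> i; rewrite mxE.
  by rewrite a0 scaler0 mul0mx addr0.
pose aa := (a *m a^T) 0 0.
have aa_gt0 : 0 < aa by apply: rV_norm_gt0.
have aaE : a *m a^T = aa%:M by rewrite [LHS]mx11_scalar.
(* The orthogonal projection along [a], acting on rows from the right. *)
pose P : 'M_m := 1%:M - aa^-1 *: (a^T *m a).
have aP : a *m P = 0.
  rewrite mulmxBr mulmx1 -scalemxAr mulmxA aaE mul_scalar_mx.
  by rewrite scalerA mulVf ?gt_eqF // scale1r subrr.
case: (IHn (B *m P)) => [[w BPw_gt0]|[u [u_neq0 u_ge0 uBP]]].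
  left; have [t t_gt0 tBw_gt0] :=
    small_perturbation (fun i => (B *m a^T) i 0) BPw_gt0.
  exists (P *m w + t *: a^T); apply: A_gt0 => [|i]; rewrite mulmxDr -scalemxAr.
    by rewrite mulmxA aP mul0mx add0r mxE mulr_gt0.
  by rewrite mulmxA !mxE -?mxE; have := tBw_gt0 i; rewrite !mxE.
pose c := aa^-1 * (u *m B *m a^T) 0 0.
have uB : u *m B = c *: a.
  move/eqP: uBP; rewrite mulmxA mulmxBr mulmx1 subr_eq0 -scalemxAr => /eqP ->.
  by rewrite mulmxA [u *m B *m a^T]mx11_scalar mul_scalar_mx scalerA.
have [c_le0|c_gt0] := leP c 0.
  right; apply: (relA (- c) u); rewrite ?oppr_ge0 ?u_neq0 ?orbT //.
  by rewrite uB scaleNr addNr.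
case: (IHn B) => [[w Bw_gt0]|[u' [u'_neq0 u'_ge0 u'B]]].
  left; exists w; apply: A_gt0 => //.
  have := mulmx_rV_gt0 u_neq0 u_ge0 Bw_gt0.
  by rewrite mulmxA uB -scalemxAl mxE pmulr_rgt0.
right; apply: (relA 0 u'); rewrite ?u'_neq0 ?orbT //.
by rewrite scale0r add0r.
Qed.

(** * Directions attaining half the number of edges *)

Section Bridge.

Variables (R : realType) (n : nat) (e : 'I_n -> 'cV[R]_3).
Implicit Type w : 'cV[R]_3.

Lemma dotZr (c : R) (x w : 'cV[R]_3) : dot x (c *: w) = c * dot x w.
Proof. by rewrite /dot mulr_sumr; apply: eq_bigr => k _; rewrite mxE mulrCA. Qed.

Lemma dotZl (c : R) (x w : 'cV[R]_3) : dot (c *: x) w = c * dot x w.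
Proof. by rewrite /dot mulr_sumr; apply: eq_bigr => k _; rewrite mxE mulrA. Qed.

Definition alternating w : Prop := forall i : 'I_n, 0 < (-1) ^+ i * dot (e i) w.

Lemma alternating_mxE w (i : 'I_n) :
  ((alternating_mx e)^T *m w) i 0 = (-1) ^+ i * dot (e i) w.
Proof.
by rewrite mxE /dot mulr_sumr; apply: eq_bigr => k _; rewrite !mxE mulrA.
Qed.

Let peaks w :=
  [set i : 'I_n | (0 < dot (e i) w) && (dot (e (ordS i)) w < 0)].

(** The two sets are disjoint, because the dot product with [w] is positive on
    the first and negative on the second, and [ordS] is injective. *)
Lemma card_peaksU w :
  #|peaks w :|: @ordS n @: peaks w| = (bridge e w).*2.
Proof.
have disj : [disjoint peaks w & @ordS n @: peaks w].
  rewrite disjoint_subset; apply/subsetP => i; rewrite !inE => /andP[i_gt0 _].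
  apply/imsetP => -[j]; rewrite inE => /andP[_ j_lt0] ij.
  by rewrite ij ltNge ltW in i_gt0.
rewrite cardsU disjoint_setI0 // cards0 subn0 card_imset; last exact: ordS_inj.
by rewrite addnn.
Qed.

Lemma bridge_le_half w : (bridge e w <= n./2)%N.
Proof.
rewrite -(half_double (bridge e w)) half_leq // -card_peaksU.
by rewrite -[leqRHS]card_ord max_card.
Qed.

(** The peaks and their successors cover all indices, so no dot product
    vanishes and the signs change at each step: a positive edge must be a
    peak, and the successor of a negative edge cannot be the successor of a
    peak, so it is a peak itself. *)
Lemma bridge_half_alternating w :
  (0 < n)%N -> ~~ odd n -> bridge e w = n./2 -> exists w', alternating w'.
Proof.
move=> n_gt0 n_even bw.
have cover i : (i \in peaks w) || (i \in @ordS n @: peaks w).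
  have/setP/(_ i) : peaks w :|: @ordS n @: peaks w = setT.
    apply/eqP; rewrite eqEcard subsetT cardsT card_ord card_peaksU bw.
    by rewrite even_halfK /=.
  by rewrite in_setU in_setT.
have opp_sign i : dot (e i) w * dot (e (ordS i)) w < 0.
  have [|iN] := boolP (i \in peaks w).
    by rewrite inE => /andP[? ?]; rewrite pmulr_rlt0.
  have: dot (e i) w < 0.
    have := cover i; rewrite (negbTE iN) => /imsetP[j].
    by rewrite inE => /andP[_ ?] ->.
  have: 0 < dot (e (ordS i)) w.
    have := cover (ordS i).
    by rewrite (mem_imset _ _ (@ordS_inj n)) (negbTE iN) orbF inE => /andP[].
  by move=> S_gt0 i_lt0; rewrite nmulr_rlt0.
pose i0 := Ordinal n_gt0.
(* Scaling by the value at index 0 makes the common sign of the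
   [(-1) ^+ i * dot (e i) w] positive. *)
exists (dot (e i0) w *: w) => -[k lt_k]; rewrite dotZr.
elim: k lt_k => [|k IHk] lt_k.
  rewrite expr0 mul1r (_ : Ordinal lt_k = i0); last exact: val_inj.
  have := opp_sign i0; rewrite -expr2 exprn_even_gt0 //=.
  by case: eqP => // ->; rewrite mul0r ltxx.
have lt_k' := ltnW lt_k.
have := opp_sign (Ordinal lt_k').
rewrite (_ : ordS _ = Ordinal lt_k); last first.
  by apply: val_inj; rewrite /= modn_small.
have /= := IHk lt_k'.
set x := dot _ w; set y := dot _ w; set z := dot (e (Ordinal lt_k)) w.
move=> xy_gt0 yz_lt0; rewrite exprS mulN1r mulNr oppr_gt0.
have y2_gt0 : 0 < y ^+ 2.
  by rewrite exprn_even_gt0 //=; case: eqP yz_lt0 => // ->; rewrite mul0r ltxx.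
rewrite -(pmulr_rlt0 _ y2_gt0).
rewrite (_ : y ^+ 2 * _ = (-1) ^+ k * (x * y) * (y * z)); last by ring.
by rewrite pmulr_rlt0.
Qed.

Lemma alternating_bridge_half w :
  ~~ odd n -> alternating w -> bridge e w = n./2.
Proof.
move=> n_even alt_w.
have gt0E (i : 'I_n) : (0 < dot (e i) w) = ~~ odd i.
  have := alt_w i; rewrite -signr_odd; case: odd => /=.
    by rewrite expr1 mulN1r oppr_gt0 => /ltW; rewrite leNgt => /negbTE.
  by rewrite expr0 mul1r.
have lt0E (i : 'I_n) : (dot (e i) w < 0) = odd i.
  have := alt_w i; rewrite -signr_odd; case: odd => /=.
    by rewrite expr1 mulN1r oppr_gt0.
  by rewrite expr0 mul1r => /ltW; rewrite leNgt => /negbTE.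
(* Parity also changes at the wrap-around from [n.-1] to [0], as [n] is even. *)
have odd_ordS (i : 'I_n) : odd (ordS i) = ~~ odd i.
  by rewrite /= odd_mod // (negbTE n_even).
have memE (i : 'I_n) : (i \in peaks w) = ~~ odd i.
  by rewrite inE gt0E lt0E odd_ordS andbb.
have cover : peaks w :|: @ordS n @: peaks w = setT.
  apply/setP => i; rewrite in_setU in_setT memE.
  rewrite -[i in X in _ || X](ord_predK i) (mem_imset _ _ (@ordS_inj n)).
  by rewrite memE -(odd_ordS (ord_pred i)) ord_predK; case: odd.
by rewrite -(half_double (bridge e w)) -card_peaksU cover cardsT card_ord.
Qed.

Lemma alternating_normalize w :
  (0 < n)%N -> alternating w -> exists w', on_S2 w' /\ alternating w'.
Proof.
move=> n_gt0 alt_w.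
have w_neq0 : w != 0.
  apply: contraTneq (alt_w (Ordinal n_gt0)) => ->.
  by rewrite -(scale0r 0) dotZr mul0r mulr0 ltxx.
have ww_gt0 : 0 < dot w w.
  have := @rV_norm_gt0 _ _ w^T; rewrite trmx_eq0 => /(_ w_neq0).
  by rewrite mxE; under eq_bigr do rewrite !mxE.
have s_gt0 : 0 < Num.sqrt (dot w w) by rewrite sqrtr_gt0.
exists ((Num.sqrt (dot w w))^-1 *: w); split=> [|i].
  rewrite /on_S2 dotZl dotZr mulrA -expr2 exprVn sqr_sqrtr ?ltW //.
  by rewrite mulVf ?gt_eqF.
by rewrite dotZr mulrCA mulr_gt0 ?invr_gt0.
Qed.

Lemma superbridge_lt_half : (0 < n)%N -> ~~ odd n ->
  (superbridge e < n./2)%N <-> ~ (exists w, alternating w).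
Proof.
move=> n_gt0 n_even; split=> [sb_lt [w0 /(alternating_normalize n_gt0)]|no_w].
  case=> w [w_S2 alt_w]; have := bridge_le_superbridge e w_S2.
  by rewrite alternating_bridge_half // leqNgt sb_lt.
have [w [_ bw]] := superbridge_attained e.
rewrite -bw ltn_neqAle bridge_le_half andbT; apply/eqP => bw_half.
exact/no_w/(bridge_half_alternating n_gt0 n_even bw_half).
Qed.

End Bridge.

Theorem corollary9 (R : realType) (n : nat) (v : 'I_n -> 'cV[R]_3)
    (n_gt0 : (0 < n)%N) (n_even : ~~ odd n) :
  (superbridge (edge v) < n./2)%N <->
  (exists u : 'cV[R]_n,
     [/\ u != 0, forall i, 0 <= u i 0 & alternating_mx (edge v) *m u = 0]).
Proof.
rewrite superbridge_lt_half //; split=> [no_w|[u [u_neq0 u_ge0 Au0]] [w alt_w]].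
  have [[w w_gt0]|[u [u_neq0 u_ge0 uA0]]] :=
      gordan (alternating_mx (edge v))^T.
    by case: no_w; exists w => i; rewrite -alternating_mxE.
  exists u^T; split=> [|i|]; rewrite ?trmx_eq0 ?mxE //.
  by apply: trmx_inj; rewrite trmx_mul trmxK uA0 trmx0.
apply: (@gordan_exclusive _ _ _ (alternating_mx (edge v))^T u^T w).
- by rewrite trmx_eq0.
- by move=> i; rewrite mxE.
- by rewrite -trmx_mul Au0 trmx0.
- by move=> i; rewrite alternating_mxE.
Qed.
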